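(* Let $G$ be a torsion-free abelian group. Then: (a) $\widetilde{s_0}(G)=0$ if and only if $r_0(G)$ is finite; (b) $\widetilde{s}(G)=\widetilde{ns}(G)$; (c) $\widetilde{s}(G)=0$ if and only if $r_0(G)\leq 1$ and no infinity appears in the type of $G$.
   Context: $\mathbb N=\{0,1,2,\dots\}$ and $\mathbb N_+=\mathbb N\setminus\{0\}$. Let $\phi$ be an endomorphism of an abelian group $G$. A string of $\phi$ is a sequence $S=\{x_n\}_{n\in\mathbb N}$ of pairwise distinct elements of $G$ such that $\phi(x_n)=x_{n-1}$ for every $n\in\mathbb N_+$. A string is singular if $\phi^j(x_0)=\phi^k(x_0)$ for some $j\neq k$ in $\mathbb N$, and non-singular otherwise; it is a null string if $x_0\neq 0$ and $\phi^k(x_0)=0$ for some $k\in\mathbb N_+$. Define $s(\phi)$ (respectively $ns(\phi)$, $s_0(\phi)$) as the supremum of the cardinalities $|\mathcal F|$, where $\mathcal F$ ranges over the families of pairwise disjoint strings (respectively non-singular strings, null strings) of $\phi$; if this supremum is infinite it is set equal to the symbol $\infty$. For an abelian group $G$, $s(G)=\sup\{s(\phi):\phi\in\mathrm{End}(G)\}$, $ns(G)=\sup\{ns(\phi):\phi\in\mathrm{End}(G)\}$, $s_0(G)=\sup\{s_0(\phi):\phi\in\mathrm{End}(G)\}$. The hereditary string numbers are $\widetilde s(G)=\sup\{s(H):H\leq G\}$, $\widetilde{ns}(G)=\sup\{ns(H):H\leq G\}$, $\widetilde{s_0}(G)=\sup\{s_0(H):H\leq G\}$, where $H$ ranges over all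 subgroups of $G$. $r_0(G)$ is the torsion-free rank. For a torsion-free abelian group $A$ of rank $1$ and $0\neq x\in A$, the $p$-height of $x$ is $h_p(x)=\sup\{n\in\mathbb N:x\in p^nA\}\in\mathbb N\cup\{\infty\}$, and the type of $A$ is the class of the sequence $(h_p(x))_p$ modulo changing finitely many finite entries to other finite values (it does not depend on $x$); infinity appears in the type of $A$ if $h_p(x)=\infty$ for some prime $p$. For the trivial group (rank $0$) the condition that no infinity appears in the type is vacuous. *)

(* Defs.v *)
From HB Require Import structures.
From mathcomp Require Import all_boot all_order all_algebra.
From mathcomp Require Import all_classical all_reals all_analysis.

Set Implicit Arguments.
Unset Strict Implicit.
Unset Printing Implicit Defensive.

Import Order.TTheory GRing.Theory Num.Theory.

Local Open Scope classical_set_scope.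
Local Open Scope ring_scope.

(* Numbers in N U {oo} are represented as extended reals over an arbitrary
   [R : realType]: [counting F] is the number of elements of [F] if [F] is
   finite and [+oo] otherwise, and all suprema below are taken over sets that
   contain an element of N U {oo}. *)

Section Strings.
Variables (G : zmodType) (phi : G -> G).

Definition is_string (x : nat -> G) : Prop :=
  injective x /\ forall n, phi (x n.+1) = x n.

Definition singular (x : nat -> G) : Prop :=
  exists j k : nat, j <> k /\ iter j phi (x 0%N) = iter k phi (x 0%N).

Definition is_nonsingular_string (x : nat -> G) : Prop :=
  is_string x /\ ~ singular x.

Definition is_null_string (x : nat -> G) : Prop :=
  [/\ is_string x, x 0%N <> 0 &
      exists k : nat, (0 < k)%N /\ iter k phi (x 0%N) = 0].

(* The empty family is always admissible. *)
Definition disjoint_family (P : (nat -> G) -> Prop) (F : set (nat -> G)) : Prop :=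
  F `<=` [set x | P x] /\ trivIset F (fun x => range x).

End Strings.

Section StringNumbers.
Variable R : realType.

Section Endomorphism.
Variables (G : zmodType) (phi : {additive G -> G}).

Definition s_end : \bar R :=
  ereal_sup [set counting F | F in disjoint_family (is_string phi)].

Definition ns_end : \bar R :=
  ereal_sup [set counting F | F in disjoint_family (is_nonsingular_string phi)].

Definition s0_end : \bar R :=
  ereal_sup [set counting F | F in disjoint_family (is_null_string phi)].

End Endomorphism.

Definition s_num (G : zmodType) : \bar R :=
  ereal_sup (range (fun phi : {additive G -> G} => s_end phi)).

Definition ns_num (G : zmodType) : \bar R :=
  ereal_sup (range (fun phi : {additive G -> G} => ns_end phi)).

Definition s0_num (G : zmodType) : \bar R :=
  ereal_sup (range (fun phi : {additive G -> G} => s0_end phi)).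

End StringNumbers.

(* A [zmodClosed G] is a boolean predicate closed under 0 and subtraction; by
   classical logic every subgroup of [G] is given by such a predicate. *)
Definition subgroup_of (G : zmodType) (H : zmodClosed G) : Type :=
  {x : G | x \in H}.

HB.instance Definition _ (G : zmodType) (H : zmodClosed G) :=
  SubChoice.on (subgroup_of H).
HB.instance Definition _ (G : zmodType) (H : zmodClosed G) :=
  [SubChoice_isSubZmodule of subgroup_of H by <:].

Section HereditaryStringNumbers.
Variables (R : realType) (G : zmodType).

Definition hered_s : \bar R :=
  ereal_sup (range (fun H : zmodClosed G => s_num R (subgroup_of H))).

Definition hered_ns : \bar R :=
  ereal_sup (range (fun H : zmodClosed G => ns_num R (subgroup_of H))).

Definition hered_s0 : \bar R :=
  ereal_sup (range (fun H : zmodClosed G => s0_num R (subgroup_of H))).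

End HereditaryStringNumbers.

Section RankAndType.
Variables (R : realType) (G : zmodType).

Definition torsion_free : Prop :=
  forall (x : G) (n : nat), (0 < n)%N -> x *+ n = 0 -> x = 0.

Definition Z_independent (A : set G) : Prop :=
  forall (e : seq G) (c : G -> int), uniq e -> [set` e] `<=` A ->
    \sum_(x <- e) x *~ c x = 0 -> forall x, x \in e -> c x = 0.

(* Torsion elements never belong to a Z-independent set, so this is the
   torsion-free rank (any infinite rank being [+oo]). *)
Definition r0 : \bar R := ereal_sup [set counting A | A in Z_independent].

Definition height (p : nat) (x : G) : \bar R :=
  ereal_sup [set n%:R%:E | n in [set n : nat | exists y : G, x = y *+ (p ^ n)%N]].

(* Meaningful for G torsion-free of rank 1, in which case the choice of the
   nonzero element x is irrelevant; it fails for the trivial group, which has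
   no nonzero element. *)
Definition infinity_in_type : Prop :=
  exists x : G, x <> 0 /\ exists p : nat, prime p /\ height p x = +oo%E.

End RankAndType.

(* Main.v *)
From HB Require Import structures.
Require Import Defs.
From mathcomp Require Import all_boot all_order all_algebra.
From mathcomp Require Import all_classical all_reals all_analysis.

Set Implicit Arguments.
Unset Strict Implicit.
Unset Printing Implicit Defensive.

Import Order.TTheory GRing.Theory Num.Theory.
Local Open Scope classical_set_scope.
Local Open Scope ring_scope.

(** Each hereditary number is governed by the bare existence of a string: if any
subgroup of [G] has a string, then some subgroup has infinitely many pairwise
disjoint nonsingular ones, namely suitable multiples of one explicit string.

For (b) and (c) there are three cases.
- If the rank is at least 2, [G] contains a copy of [Z^2], and the shear
  [(a, b) |-> (a + b, b)] has the disjoint nonsingular strings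
  [n |-> (- n k, k)] for [k >= 1]; hence [hered_ns = hered_s = +oo]
  ([hered_ns_eqy_of_free_pair]).
- If some [x <> 0] is divisible by all powers of a prime [p], multiplication by
  [p] has the nonsingular string [x / p^n], and so [hered_ns = hered_s = +oo]
  ([hered_ns_eqy_of_divisible]).
- Otherwise any endomorphism of a nonzero subgroup is multiplication by a
  reduced fraction [a / b]. A string [x] then satisfies
  [b^n x_i = a^n x_(n+i)] and [b^n phi^n(x_i) = a^n x_i]. Since [a] and [b] are
  coprime, a nonzero [x_i] is divisible by all powers of any prime dividing [a]
  or [b]; so [a] and [b] are units and [phi] is plus or minus the identity,
  which is an involution and has no string ([dependent_string_divisible]). Both
  numbers vanish.

For (a), the members of a null string are independent: applying a suitable
power of [phi] to a relation kills all its terms except the one of largest index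
([null_string_Z_independent]), so a null string forces infinite rank.
Conversely, in infinite rank a maximal independent set, given by Zorn's lemma,
must be infinite, because a finite one would bound the rank by its size
([r0_le_size]). A sequence of distinct elements of it is a basis of a copy of
[Z[X]], where removing the constant term and dividing by [X] has the null string
[1, X, X^2, ...] ([hered_s0_neq0_of_free_sequence]). *)

(** * Counting elements of a set *)

Section Counting.
Variables (R : realType) (T : choiceType).
Implicit Types (A : set T) (t : seq T).
Local Notation counting := (@counting T R).

Lemma size_le_counting A t :
  uniq t -> [set` t] `<=` A -> ((size t)%:R%:E <= counting A)%E.
Proof.
move=> ut tA; rewrite /counting.
case: ifPn => [/asboolP fA|_]; last exact: leey.
rewrite lee_fin ler_nat; apply: uniq_leq_size => // z zt.
by rewrite in_fset_set// inE; apply: tA.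
Qed.

Lemma counting_gt_uniq_seq A n : (n%:R%:E < counting A)%E ->
  exists t, [/\ uniq t, size t = n.+1 & [set` t] `<=` A].
Proof.
have [fA|iA] := pselect (finite_set A).
  rewrite /counting asboolT// lte_fin ltr_nat => nA.
  exists (take n.+1 (finmap.enum_fset (fset_set A))); split.
  - exact/take_uniq/finmap.fset_uniq.
  - by rewrite size_take_min; apply/minn_idPl.
  - by move=> z /mem_take; rewrite in_fset_set// inE.
move=> _; have [B BA nB] := infinite_set_fset n.+1 iA.
exists (take n.+1 (finmap.enum_fset B)); split.
- exact/take_uniq/finmap.fset_uniq.
- by rewrite size_take_min; apply/minn_idPl.
- by move=> z /mem_take zB; apply: BA.
Qed.

Lemma counting_infinite A : infinite_set A -> counting A = +oo%E.
Proof. by move=> iA; rewrite /counting asboolF. Qed.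

Lemma infinite_range (f : nat -> T) : injective f -> infinite_set (range f).
Proof.
move=> fI; have -> : infinite_set (range f) = infinite_set [set: nat].
  by rewrite (eq_finite_set (inj_card_eq _))// => ? ? _ _; apply: fI.
exact: infinite_nat.
Qed.

End Counting.
(** * Strings along an injective morphism *)

(** Endomorphisms are easiest to write down on a model group [F] (here [Z^2],
[Z[X]] or [G] itself); the image of an injective morphism [F -> G] is then the
subgroup of [G] that carries the corresponding endomorphism. *)

Section Transport.
Variables (F G : zmodType) (f : {additive F -> G}).

Definition image_pred : {pred G} := fun y => `[< exists x, f x = y >].

Lemma image_pred_zmod_closed : zmod_closed image_pred.
Proof.
split=> [|_ _ /asboolP[x <-] /asboolP[y <-]]; apply/asboolP.
  by exists 0; rewrite raddf0.
by exists (x - y); rewrite raddfB.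
Qed.

HB.instance Definition _ :=
  GRing.isZmodClosed.Build G image_pred image_pred_zmod_closed.

Definition image_group : zmodClosed G := image_pred.

Lemma mem_image_group x : f x \in image_group.
Proof. by apply/asboolP; exists x. Qed.

Definition to_image (x : F) : subgroup_of image_group :=
  exist _ (f x) (mem_image_group x).

Hypothesis f_inj : injective f.

Variable psi : {additive F -> F}.

Lemma endo_of_image :
  exists phi : {additive subgroup_of image_group -> subgroup_of image_group},
    forall x, phi (to_image x) = to_image (psi x).
Proof.
have preim (y : subgroup_of image_group) : {x | to_image x = y}.
  apply: cid; case: y => y; rewrite /in_mem /= => yH; have /asboolP[x xy] := yH.
  by exists x; apply: val_inj.
pose g y := projT1 (preim y).
have gK y : to_image (g y) = y by exact: projT2 (preim y).
have to_imageI : injective to_image by move=> x y [/f_inj].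
have to_imageB : {morph to_image : x y / x - y}.
  by move=> x y; apply: val_inj; rewrite /= raddfB.
have phiB : zmod_morphism (to_image \o psi \o g).
  move=> x y /=; rewrite -to_imageB -raddfB; congr (to_image (psi _)).
  by apply: to_imageI; rewrite gK to_imageB !gK.
pose phiA := GRing.isZmodMorphism.Build _ _ _ phiB.
pose phi : {additive subgroup_of image_group -> subgroup_of image_group} :=
  HB.pack (to_image \o psi \o g) phiA.
exists phi => x /=.
by congr (to_image (psi _)); apply: to_imageI; rewrite gK.
Qed.

End Transport.

Section Semiconjugacy.
Variables (F K : zmodType) (psi : F -> F) (phi : K -> K) (g : F -> K).
Hypotheses (g_inj : injective g) (gpsi : forall x, phi (g x) = g (psi x)).

Lemma iter_semiconj k x : iter k phi (g x) = g (iter k psi x).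
Proof. by elim: k => //= k ->. Qed.

Lemma is_string_semiconj x : is_string psi x -> is_string phi (g \o x).
Proof.
by move=> [xI xS]; split=> [|n /=]; [exact: inj_comp | rewrite gpsi xS].
Qed.

Lemma is_nonsingular_string_semiconj x :
  is_nonsingular_string psi x -> is_nonsingular_string phi (g \o x).
Proof.
move=> [sx nx]; split; first exact: is_string_semiconj.
move=> [j [k [jk e]]]; apply: nx; exists j, k; split=> //.
by move: e; rewrite /= !iter_semiconj => /g_inj.
Qed.

Lemma is_null_string_semiconj x : g 0 = 0 ->
  is_null_string psi x -> is_null_string phi (g \o x).
Proof.
move=> g0 [sx x0 [k [k0 xk]]]; split; first exact: is_string_semiconj.
  by rewrite /= -g0 => /g_inj.
by exists k; split=> //=; rewrite iter_semiconj xk.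
Qed.

End Semiconjugacy.

(** * Hereditary string numbers *)

(** The common shape of the three hereditary numbers: [P] is the kind of string
that is counted. *)
Definition hered_num (R : realType) (G : zmodType)
    (P : forall K : zmodType, (K -> K) -> (nat -> K) -> Prop) : \bar R :=
  ereal_sup (range (fun H : zmodClosed G =>
    ereal_sup (range (fun phi : {additive subgroup_of H -> subgroup_of H} =>
      ereal_sup [set counting F | F in disjoint_family (P _ phi)])))).

Section HereditaryNumbers.
Variables (R : realType) (G : zmodType).
Variable P : forall K : zmodType, (K -> K) -> (nat -> K) -> Prop.

Lemma hered_sE : hered_s R G = hered_num R G (@is_string).
Proof. by []. Qed.

Lemma hered_nsE : hered_ns R G = hered_num R G (@is_nonsingular_string).
Proof. by []. Qed.

Lemma hered_s0E : hered_s0 R G = hered_num R G (@is_null_string).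
Proof. by []. Qed.

Lemma counting_le_hered_num (H : zmodClosed G)
    (phi : {additive subgroup_of H -> subgroup_of H}) F :
  disjoint_family (P phi) F -> (counting F <= hered_num R G P)%E.
Proof.
move=> dF; apply: le_trans (ereal_sup_ubound _); last by exists H.
apply: le_trans (ereal_sup_ubound _); last by exists phi.
by apply: ereal_sup_ubound; exists F.
Qed.

Lemma hered_num_le (M : \bar R) :
    (forall (H : zmodClosed G)
       (phi : {additive subgroup_of H -> subgroup_of H}) F,
      disjoint_family (P phi) F -> (counting F <= M)%E) ->
  (hered_num R G P <= M)%E.
Proof.
move=> leM; apply: ge_ereal_sup => _ [H _ <-].
apply: ge_ereal_sup => _ [phi _ <-]; apply: ge_ereal_sup => _ [F dF <-].
exact: leM dF.
Qed.

Lemma hered_num_ge0 : (0 <= hered_num R G P)%E.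
Proof.
pose H : zmodClosed G := image_group (@idfun G).
have := @counting_le_hered_num H idfun set0.
rewrite {1}/counting asboolT// fset_set0; apply.
by split=> [x []|x y []].
Qed.

(** A single string already makes a family of cardinality 1, and without any
string the only family is the empty one. *)
Lemma hered_num_eq0 : hered_num R G P = 0%E <->
  forall (H : zmodClosed G) (phi : {additive subgroup_of H -> subgroup_of H}) x,
    ~ P phi x.
Proof.
split=> [P0 H phi x Px|noP].
  have : ((size [:: x])%:R%:E <= hered_num R G P)%E.
    apply: le_trans (@counting_le_hered_num H phi [set x] _); last first.
      by split; [move=> _ -> | exact: trivIset1].
    by apply: size_le_counting => // y /=; rewrite inE => /eqP.
  by rewrite P0 lee_fin ler10.
apply/eqP; rewrite eq_le; apply/andP; split.
  apply: hered_num_le => H phi F [FP _].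
  suff -> : F = set0 by rewrite /counting asboolT// fset_set0.
  by rewrite -subset0 => x /FP /noP.
exact: hered_num_ge0.
Qed.

End HereditaryNumbers.

Lemma hered_num_mono (R : realType) (G : zmodType) P Q :
  (forall (K : zmodType) (phi : K -> K) x, P K phi x -> Q K phi x) ->
  (hered_num R G P <= hered_num R G Q)%E.
Proof.
move=> PQ; apply: hered_num_le => H phi F [FP tF].
by apply: (@counting_le_hered_num _ _ Q H phi F); split=> // x /FP; exact: PQ.
Qed.

Section TransportedStrings.
Variables (R : realType) (F G : zmodType).
Variables (f : {additive F -> G}) (f_inj : injective f).
Variable psi : {additive F -> F}.

Lemma to_image_inj : injective (to_image f).
Proof. by move=> x y [/f_inj]. Qed.

Lemma hered_s0_neq0_of_null_string x :
  is_null_string psi x -> hered_s0 R G <> 0%E.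
Proof.
move=> nx; rewrite hered_s0E => /hered_num_eq0 nos.
have [phi phiE] := endo_of_image f_inj psi.
have nos_x := nos _ phi (to_image f \o x); apply: nos_x.
have := is_null_string_semiconj to_image_inj phiE; apply=> //.
by apply: val_inj; rewrite /= raddf0.
Qed.

(** The second hypothesis says that the ranges are pairwise disjoint, which also
makes the strings distinct; they form an infinite admissible family. *)
Lemma hered_ns_eqy_of_strings (s : nat -> nat -> F) :
    (forall i, is_nonsingular_string psi (s i)) ->
    (forall i j m n, s i m = s j n -> i = j) ->
  hered_ns R G = +oo%E.
Proof.
move=> ns s_disj; rewrite hered_nsE.
have [phi phiE] := endo_of_image f_inj psi.
pose t i := to_image f \o s i.
have tE i j m n : t i m = t j n -> i = j by move=> /to_image_inj /s_disj.
apply/eqP; rewrite -leye_eq -(@counting_infinite R _ (range t)).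
  apply: (@counting_le_hered_num _ _ _ _ phi); split=> [_ [i _ <-]|].
    exact: (is_nonsingular_string_semiconj to_image_inj phiE).
  move=> _ _ [i _ <-] [j _ <-] [y [[m _ <-] [n _ tjn]]].
  by rewrite (tE _ _ _ _ tjn).
by apply: infinite_range => i j ij; apply: (tE i j 0 0); rewrite ij.
Qed.

End TransportedStrings.

Lemma hered_ns_le (R : realType) (G : zmodType) :
  (hered_ns R G <= hered_s R G)%E.
Proof. by rewrite hered_nsE hered_sE; apply: hered_num_mono => K phi x []. Qed.

(** * Groups with infinitely many nonsingular strings *)

Definition shear (u : int * int) : int * int := (u.1 + u.2, u.2).

Lemma shear_zmod_morphism : zmod_morphism shear.
Proof. by move=> u v; congr pair; rewrite /= opprD addrACA. Qed.

HB.instance Definition _ :=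
  GRing.isZmodMorphism.Build _ _ shear shear_zmod_morphism.

Lemma iter_shear k u : iter k shear u = (u.1 + u.2 *+ k, u.2).
Proof.
elim: k => [|k /= ->]; first by case: u => a b; rewrite addr0.
by rewrite /shear /= mulrSr addrA.
Qed.

(** An element [(a, b)] of [Z^2] with [b <> 0] has an infinite orbit under the
shear in both directions, and the orbits for different [b] are disjoint. *)
Lemma hered_ns_eqy_of_free_pair (R : realType) (G : zmodType) (x y : G) :
    (forall a b : int, x *~ a = y *~ b -> a = 0 /\ b = 0) ->
  hered_ns R G = +oo%E.
Proof.
move=> xy.
(* With this sign, injectivity of [f0] is exactly the hypothesis [xy]. *)
pose f0 (u : int * int) := x *~ u.1 - y *~ u.2.
have f0B : zmod_morphism f0.
  by move=> u v; rewrite /f0 /= !mulrzBr opprD addrACA -opprD.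
pose f : {additive (int * int)%type -> G} :=
  HB.pack f0 (GRing.isZmodMorphism.Build _ _ _ f0B).
have f_inj : injective f.
  move=> u v /eqP; rewrite -subr_eq0 -raddfB subr_eq0 => /eqP/xy[/= e1 e2].
  by apply/eqP; rewrite -subr_eq0; apply/eqP; congr pair.
pose s (i n : nat) : int * int := (- (i.+1%:Z *+ n), i.+1%:Z).
apply: (@hered_ns_eqy_of_strings R _ _ f f_inj shear s) => [i|i j m n [_]//].
split; first split.
- by move=> m n [/oppr_inj]; apply: mulrIn.
- by move=> n; congr pair; rewrite /= mulrSr opprD; exact: subrK.
- move=> [j [k [jk]]]; rewrite !iter_shear /s /= => -[/addrI].
  by move/mulrIn => /(_ isT).
Qed.

Lemma torsion_free_muln_injl (G : zmodType) n :
  torsion_free G -> (0 < n)%N -> injective (fun x : G => x *+ n).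
Proof.
move=> tf n0 x y /eqP; rewrite -subr_eq0 -mulrnBl => /eqP/tf-/(_ n0)/eqP.
by rewrite subr_eq0 => /eqP.
Qed.

Lemma torsion_free_muln_injr (G : zmodType) (x : G) :
  torsion_free G -> x <> 0 -> injective (GRing.natmul x).
Proof.
move=> tf x0 m n; wlog mn : m n / (m <= n)%N => [hw e|e].
  by case: (leqP m n) => [|/ltnW] mn; [exact: hw | apply/esym/hw].
apply/eqP; rewrite eqn_leq mn /= leqNgt -subn_gt0; apply/negP => nm.
by apply/x0/(tf x _ nm); rewrite mulrnBr// e subrr.
Qed.

(** The multipliers [1 + p * i] are prime to [p], so a fraction
[(1 + p * i) / p ^ n] is reduced and determines both [n] and [i]. *)
Lemma expn_mul_cong1_inj p m n i j : (1 < p)%N ->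
  (p ^ m * (1 + p * i) = p ^ n * (1 + p * j))%N -> m = n /\ i = j.
Proof.
move=> p1; have p0 : (0 < p)%N by exact: ltnW.
have mod1 k : ((1 + p * k) %% p = 1)%N.
  by rewrite addnC mulnC modnMDl modn_small.
elim: m n => [|m IH] [|n].
- by rewrite !expn0 !mul1n => /addnI/eqP; rewrite eqn_pmul2l// => /eqP ->.
- rewrite expn0 mul1n expnS -mulnA => /(congr1 (modn^~ p)).
  by rewrite mod1 modnMr.
- rewrite expn0 mul1n expnS -mulnA => /(congr1 (modn^~ p)).
  by rewrite mod1 modnMr.
- by rewrite !expnS -!mulnA => /eqP; rewrite eqn_pmul2l// => /eqP/IH[-> ->].
Qed.

(** Multiplication by [p] on [G] has the string [x / p^n], and its multiples by
integers congruent to 1 modulo [p] are pairwise disjoint. *)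
Lemma hered_ns_eqy_of_divisible (R : realType) (G : zmodType) (x : G) p :
    torsion_free G -> x <> 0 -> (1 < p)%N ->
    (forall n, exists y, x = y *+ (p ^ n)) ->
  hered_ns R G = +oo%E.
Proof.
move=> tf x0 p1 /choice[y yE].
have p0 n : (0 < p ^ n)%N by rewrite expn_gt0 ltnW.
have mulp_zmod : zmod_morphism (fun z : G => z *+ p).
  by move=> u v; rewrite mulrnBl.
pose mulp : {additive G -> G} :=
  HB.pack (fun z : G => z *+ p) (GRing.isZmodMorphism.Build _ _ _ mulp_zmod).
have iter_mulp k z : iter k mulp z = z *+ p ^ k.
  by elim: k => //= k ->; rewrite -mulrnA expnSr.
have yS n : y n.+1 *+ p = y n.
  by apply: (torsion_free_muln_injl tf (p0 n)); rewrite /= -mulrnA -expnS -!yE.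
pose s (i n : nat) : G := y n *+ (1 + p * i).
have sE i j m n : s i m = s j n -> m = n /\ i = j.
  move=> /(congr1 (fun z => z *+ p ^ m *+ p ^ n)) e.
  suff : (p ^ n * (1 + p * i) = p ^ m * (1 + p * j))%N.
    by move=> /(expn_mul_cong1_inj p1)[].
  apply: (torsion_free_muln_injr tf x0); rewrite {1}(yE m) {1}(yE n).
  (* Both sides come from [e] by reordering the multipliers. *)
  have rot3 (z : G) a b c : z *+ a *+ b *+ c = z *+ c *+ a *+ b.
    by rewrite (mulrnAC _ b) (mulrnAC _ a).
  by rewrite !mulrnA (rot3 (y m)) (rot3 (y n)) [RHS]mulrnAC; exact: e.
apply: (@hered_ns_eqy_of_strings R _ _ idfun _ mulp s) => // [i|i j m n];
  last by move=> /sE[].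
split; first split=> [m n|n].
- by move=> /sE[].
- by rewrite /= /s -mulrnAC yS.
move=> [j [k [jk]]]; rewrite !iter_mulp; apply: contra_not jk.
have s0 : s i 0 <> 0.
  move=> /tf; rewrite add1n => /(_ isT) y0.
  by apply: x0; rewrite (yE 0) y0 mul0rn.
by move=> /(torsion_free_muln_injr tf s0)/(expnI p1).
Qed.

(** The sequence [e] is the basis of a copy of [Z[X]], with [e i] in the role of
[X^i]; the left shift of this basis is [drop_poly 1]. *)
Lemma hered_s0_neq0_of_free_sequence
    (R : realType) (G : zmodType) (e : nat -> G) :
    (forall n (c : nat -> int), \sum_(i < n) e i *~ c i = 0 ->
      forall i, (i < n)%N -> c i = 0) ->
  hered_s0 R G <> 0%E.
Proof.
move=> e_free.
pose f0 (q : {poly int}) := \sum_(i < size q) e i *~ q`_i.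
have f0E n (q : {poly int}) :
    (size q <= n)%N -> f0 q = \sum_(i < n) e i *~ q`_i.
  move=> qn; rewrite /f0 (big_ord_widen n (fun i => e i *~ q`_i))// big_mkcond.
  apply: eq_bigr => i _; case: ltnP => // /(nth_default 0) ->.
  by rewrite mulr0z.
have f0B : zmod_morphism f0.
  move=> q r; pose n := maxn (size q) (size r).
  rewrite !(f0E n) ?leq_maxl ?leq_maxr//; last first.
    by apply: leq_trans (size_polyD _ _) _; rewrite size_polyN.
  by rewrite -sumrB; apply: eq_bigr => i _; rewrite coefB mulrzBr.
pose f : {additive {poly int} -> G} :=
  HB.pack f0 (GRing.isZmodMorphism.Build _ _ _ f0B).
have f_inj : injective f.
  move=> q r /eqP; rewrite -subr_eq0 -raddfB => /eqP fqr.
  apply/eqP; rewrite -subr_eq0; apply/eqP/polyP => i; rewrite coef0.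
  case: (ltnP i (size (q - r))) => [|/(nth_default 0)//].
  exact: (e_free _ (fun i => (q - r)`_i)).
apply: (@hered_s0_neq0_of_null_string R _ _ f f_inj (drop_poly 1)
  (fun n => 'X^n)).
split; first split=> [m n|n].
- move=> /(congr1 (fun q : {poly int} => size q)).
  by rewrite !size_polyXn => -[].
- by rewrite exprSr; exact: drop_polyMXn_id.
- by apply/eqP; rewrite expr0 oner_eq0.
- by exists 1%N; split=> //=; rewrite drop_poly_eq0// size_poly1.
Qed.

(** * Independent sets and the torsion-free rank *)

Lemma Z_independent_sub (G : zmodType) (A B : set G) :
  A `<=` B -> Z_independent B -> Z_independent A.
Proof. by move=> AB iB e c ue eA; apply: iB => // z /eA /AB. Qed.

(** For a finite set it is enough to test relations that involve all its
elements: any other relation is completed by zero coefficients. *)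
Lemma Z_independent_seq (G : zmodType) (s : seq G) : uniq s ->
  Z_independent [set` s] <->
  forall c : G -> int, \sum_(z <- s) z *~ c z = 0 ->
    forall z, z \in s -> c z = 0.
Proof.
move=> us; split=> [iA c|hs e c ue es sum0 z ze]; first exact: iA.
have := hs (fun z => if z \in e then c z else 0); rewrite (eq_bigr
  (fun z => if z \in e then z *~ c z else 0)); last first.
  by move=> y _; case: ifP.
rewrite -big_mkcond -big_filter (perm_big e); last first.
  apply: uniq_perm => //; first exact: filter_uniq.
  by move=> y; rewrite mem_filter; apply: andb_idr => /es.
by move=> /(_ sum0 z (es z ze)); rewrite ze.
Qed.

(** This is rank at most 1, stated without counting. For torsion-free groups
both [a] and [b] are nonzero unless [x] or [y] vanishes. *)
Definition pairwise_dependent (G : zmodType) : Prop :=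
  forall x y : G, exists a b : int, (a, b) <> (0, 0) /\ x *~ a = y *~ b.

Section Rank.
Variables (R : realType) (G : zmodType).

Lemma counting_le_r0 (A : set G) :
  Z_independent A -> (counting A <= r0 R G)%E.
Proof. by move=> iA; apply: ereal_sup_ubound; exists A. Qed.

Lemma r0_gt_seq n : (n%:R%:E < r0 R G)%E ->
  exists t : seq G, [/\ uniq t, size t = n.+1 & Z_independent [set` t]].
Proof.
move=> /ereal_sup_gt[_ [A iA <-]] /counting_gt_uniq_seq[t [ut st tA]].
by exists t; split=> //; exact: Z_independent_sub iA.
Qed.

Lemma r0_le1P : (r0 R G <= 1)%E <-> pairwise_dependent G.
Proof.
split=> [r1 x y|dep].
  apply: contrapT => noab.
  have xy a b : x *~ a = y *~ b -> a = 0 /\ b = 0.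
    move=> e; apply: contrapT => ab; apply: noab; exists a, b.
    by split=> // -[a0 b0]; apply: ab.
  have xNy : x != y.
    by apply/eqP => exy; have [] := xy 1 1 (congr1 (fun z => z *~ 1) exy).
  suff /counting_le_r0/le_trans/(_ r1) : Z_independent [set` [:: x; y]].
    move=> le1; suff : (2%:R%:E <= 1 :> \bar R)%E.
      by rewrite lee_fin (ler_nat R 2 1).
    apply: le_trans le1; apply: (@size_le_counting R _ _ [:: x; y]) => //.
    by rewrite /= inE xNy.
  apply/Z_independent_seq => [|c]; first by rewrite /= inE xNy.
  rewrite big_cons big_seq1 => /eqP; rewrite addr_eq0 -mulrNz => /eqP/xy[cx cy].
  by move=> z; rewrite !inE => /orP[]/eqP->//; apply/eqP; rewrite -oppr_eq0 cy.
rewrite leNgt; apply/negP => /(@r0_gt_seq 1)[t []].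
case: t => [|x [|y []]]// uxy _; move=> /(Z_independent_seq uxy) ixy.
have [a [b [ab e]]] := dep x y; apply: ab.
move: uxy; rewrite /= inE andbT => xNy.
have := ixy (fun z => if z == x then a else - b).
rewrite big_cons big_seq1 eqxx eq_sym (negbTE xNy) e mulrNz subrr.
move=> /(_ erefl) c0.
have := c0 x; rewrite eqxx inE eqxx => /(_ isT) ->.
have := c0 y; rewrite eq_sym (negbTE xNy) !inE eqxx orbT => /(_ isT)/eqP.
by rewrite oppr_eq0 => /eqP ->.
Qed.

Lemma infinite_Z_independent_r0 (A : set G) :
  Z_independent A -> infinite_set A -> r0 R G = +oo%E.
Proof.
move=> iA infA; apply/eqP; rewrite -leye_eq -(counting_infinite R infA).
exact: counting_le_r0.
Qed.

End Rank.

(** In the Smith normal form [M = L D Q], the matrix [D] has more rows than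
columns, so its last row is zero; the last row of the inverse of [L] therefore
annihilates [M]. *)
Lemma int_left_kernel n (M : 'M[int]_(n.+1, n)) :
  exists2 w : 'rV[int]_n.+1, w != 0 & w *m M = 0.
Proof.
have [L uL [Q _ [d _ ->]]] := int_Smith_normal_form M.
exists (row ord_max (invmx L)).
  apply/eqP => /(congr1 (fun w => w *m L)); rewrite -row_mul mulVmx// mul0mx.
  by move=> /rowP/(_ ord_max); rewrite !mxE eqxx.
rewrite !mulmxA -row_mul mulVmx// -row_mul mul1mx.
rewrite (_ : row _ _ = 0) ?mul0mx//.
apply/rowP => j; rewrite !mxE /=.
by rewrite gtn_eqF.
Qed.

(** Independence concerns finitely many elements at a time, and those of a
finite part of the union of a chain all lie in one member of the chain. *)
Lemma Z_independent_bigcup (G : zmodType) (F : set (set G)) :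
  F `<=` @Z_independent G -> total_on F subset ->
  Z_independent (\bigcup_(X in F) X).
Proof.
move=> Find Ftot e c ue eF.
have [->|e0] := eqVneq e [::]; first by [].
suff [X FX eX] : exists2 X, F X & [set` e] `<=` X by exact: (Find X).
move: e0; elim: e eF {ue} => [//|x e IH] eF _.
have [X FX Xx] : (\bigcup_(X in F) X) x by apply: eF; rewrite /= inE eqxx.
have [e0|e0] := eqVneq e [::].
  by exists X => //; rewrite e0 => y /=; rewrite inE => /eqP ->.
have [|Y FY eY] := IH _ e0.
  by move=> y ye; apply: eF; rewrite /= inE ye orbT.
have [XY|YX] := Ftot X Y FX FY; [exists Y|exists X] => // y /=;
  rewrite inE => /orP[/eqP ->|/eY] //; [exact: XY | exact: YX].
Qed.

Section MaximalIndependent.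
Variables (R : realType) (G : zmodType) (s : seq G).
Hypotheses (s_uniq : uniq s) (s_indep : Z_independent [set` s]).
Hypothesis s_max : forall B, [set` s] `<` B -> ~ Z_independent B.

(** Adjoining a new [g] to a maximal independent set creates a relation, and [g] must
occur in it with a nonzero coefficient. *)
Lemma multiple_in_span g : exists kv : int * 'rV[int]_(size s),
  kv.1 != 0 /\ g *~ kv.1 = \sum_(i < size s) s`_i *~ kv.2 0 i.
Proof.
have [gs|gNs] := boolP (g \in s).
  have gi : (index g s < size s)%N by rewrite index_mem.
  exists (1, delta_mx 0 (Ordinal gi)); split=> //=.
  rewrite (bigD1 (Ordinal gi))//= big1 => [|i iN]; last first.
    by rewrite mxE (negbTE iN) andbF mulr0z.
  by rewrite !mxE !eqxx addr0 nth_index.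
have ugs : uniq (g :: s) by rewrite /= gNs.
have /s_max : [set` s] `<` [set` g :: s].
  split=> [z /= zs|sub]; first by rewrite inE zs orbT.
  have /sub /= gs : [set` g :: s] g by rewrite /= inE eqxx.
  by rewrite gs in gNs.
move=> /(Z_independent_seq ugs)/existsNP[c /not_implyP[]].
rewrite big_cons => sum0 /existsNP[z /not_implyP[zs cz]].
have cg : c g != 0.
  apply/eqP => cg0; apply: cz; move: sum0 zs; rewrite cg0 mulr0z add0r => sum0.
  rewrite inE => /orP[/eqP -> //|]; exact: (s_indep s_uniq _ sum0).
exists (c g, \row_i - c s`_i); split=> //=.
move/eqP: sum0; rewrite addr_eq0 => /eqP ->.
rewrite (big_nth 0) big_mkord -sumrN; apply: eq_bigr => i _.
by rewrite mxE mulrNz.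
Qed.

(** If [t] has more elements than [s], nonzero multiples of the elements of [t]
have coordinates with respect to [s] forming a matrix with more rows than
columns; a vector in its left kernel is a relation between the elements of
[t]. *)
Lemma r0_le_size : (r0 R G <= (size s)%:R%:E)%E.
Proof.
rewrite leNgt; apply/negP => /r0_gt_seq[t [ut st it]].
have [kv kvE] := choice multiple_in_span.
pose M : 'M[int]_((size s).+1, size s) := \matrix_(j, i) (kv t`_j).2 0 i.
have [w w0 wM] := int_left_kernel M.
pose c z := (kv z).1 * w 0 (inord (index z t)).
have /Z_independent_seq := it => /(_ ut c) c0.
move/negP: w0; apply; apply/eqP/rowP => j; rewrite !mxE.
have jt : (j < size t)%N by rewrite st.
have := c0 _ t`_j (mem_nth 0 jt); rewrite /c index_uniq// inord_val.
have [k0 _] := kvE t`_j.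
move=> /(_ _)/eqP; rewrite mulf_eq0 (negbTE k0) /= => h.
apply/eqP/h => {h c0}.
rewrite (big_nth 0) st big_mkord.
transitivity (\sum_(l < (size s).+1) \sum_(i < size s) s`_i *~ (w 0 l * M l i)).
  apply: eq_bigr => l _; rewrite index_uniq ?st// inord_val.
  rewrite mulrzA (kvE t`_l).2.
  rewrite mulrz_suml; apply: eq_bigr => i _.
  by rewrite mxE mulrC mulrzA.
rewrite exchange_big big1// => i _; rewrite -mulrz_sumr.
by move/rowP/(_ i): wM; rewrite !mxE => ->; rewrite mulr0z.
Qed.

End MaximalIndependent.

Lemma infinite_rank_independent_set (R : realType) (G : zmodType) :
  ~ (r0 R G < +oo)%E -> exists2 A : set G, Z_independent A & infinite_set A.
Proof.
move=> r0oo; have [A [iA Amax]] := Zorn_bigcup (@Z_independent_bigcup G).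
exists A => // /finite_fsetP[X AX]; apply: r0oo.
rewrite AX in iA Amax.
have le := r0_le_size R (finmap.fset_uniq X) iA Amax.
exact: le_lt_trans le (ltry _).
Qed.

(** An infinite independent set, enumerated without repetition. *)
Lemma infinite_rank_free_sequence (R : realType) (G : zmodType) :
  ~ (r0 R G < +oo)%E -> exists e : nat -> G,
    forall n (c : nat -> int), \sum_(i < n) e i *~ c i = 0 ->
      forall i, (i < n)%N -> c i = 0.
Proof.
move=> /infinite_rank_independent_set[A iA /infiniteP A_inf].
(* Extracting a function out of an injection of sets needs a default value. *)
pose Gp : pointedType := HB.pack (GRing.Zmodule.sort G) (isPointed.Build G 0).
have /injfunPex[e eA eIn] := elimT (@pcard_leP _ Gp _ _) A_inf.
have eI : injective e by move=> i j; apply: eIn; rewrite inE.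
have /choice[d dE] : forall g : G, exists i, forall j, e j = g -> i = j.
  move=> g; have [[j <-]|nog] := pselect (exists j, e j = g).
    by exists j => k /eI.
  by exists 0%N => j ej; case: nog; exists j.
have dK j : d (e j) = j by exact: dE.
exists e => n c sum0 i lt_in.
have := iA (map e (iota 0 n)) (c \o d).
rewrite map_inj_uniq// iota_uniq big_map => /(_ erefl) h.
have /= := h _ _ (e i); rewrite dK; apply.
- by move=> g /mapP[j _ ->]; apply: eA.
- rewrite -[n]subn0 -/(index_iota 0 n) big_mkord -[RHS]sum0.
  by apply: eq_bigr => j _ /=; rewrite dK.
- by rewrite map_f// mem_iota.
Qed.

(** * Null strings are independent *)

Lemma torsion_free_mulrz_eq0 (K : zmodType) (x : K) (n : int) :
  torsion_free K -> x *~ n = 0 -> n <> 0 -> x = 0.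
Proof.
move=> tf; case: n => [[//|n]|n] xn _; first exact: (tf x n.+1).
by apply: (tf x n.+1) => //; apply/eqP; rewrite -oppr_eq0; apply/eqP.
Qed.

Lemma torsion_free_inj (K G : zmodType) (f : {additive K -> G}) :
  injective f -> torsion_free G -> torsion_free K.
Proof.
move=> fI tf x n n0 xn; apply: fI; rewrite raddf0; apply: (tf _ n n0).
by rewrite -raddfMn xn raddf0.
Qed.

Lemma iter_zmod_morphism (K : zmodType) (phi : {additive K -> K}) k :
  zmod_morphism (iter k phi).
Proof. by elim: k => [//|k IH] x y; rewrite /= IH raddfB. Qed.

Lemma iter_string (K : zmodType) (phi : K -> K) x m n :
  is_string phi x -> iter m phi (x (m + n)%N) = x n.
Proof. by move=> [_ xS]; elim: m => // m IH; rewrite iterSr addSn xS. Qed.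

(** Let [m] be the last exponent with [phi^m(x_0) <> 0]. If [N] is the largest
index occurring in a relation, [phi^(m+N)] sends [x_N] to [phi^m(x_0)] and kills
every [x_i] with [i < N]; so the coefficient of [x_N] is zero. *)
Lemma null_string_Z_independent (K G : zmodType) (f : {additive K -> G})
    (phi : {additive K -> K}) x :
  injective f -> torsion_free G -> is_null_string phi x ->
  Z_independent (range (f \o x)).
Proof.
move=> fI tf [sx x0 /cid[k0 [_ k0P]]].
have [m xm xmS] : exists2 m, iter m phi (x 0) <> 0 & iter m.+1 phi (x 0) = 0.
  have ex : exists k, iter k phi (x 0) == 0 by exists k0; apply/eqP.
  case: (ex_minnP ex) => -[/eqP//|m] /eqP xm min_m; exists m => //.
  by move=> /eqP/min_m; rewrite ltnn.
have kill j : (m < j)%N -> iter j phi (x 0) = 0.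
  move=> mj; rewrite -(subnK mj) iterD xmS.
  by elim: (j - m.+1)%N => //= i ->; rewrite raddf0.
have pull j : iter j phi (x j) = x 0 by rewrite -{2}[j]addn0 iter_string.
have /choice[d dE] : forall g : G, exists i, range (f \o x) g -> f (x i) = g.
  move=> g; have [[i _ <-]|nog] := pselect (range (f \o x) g).
    by exists i.
  by exists 0.
move=> e c ue er sum0 z ze; apply/eqP/negP => /negP cz.
have ed y : y \in e -> f (x (d y)) = y by move=> /er/dE.
(* [t] is the term of largest index among those with a nonzero coefficient. *)
pose P N := has (fun y => (c y != 0) && (d y == N)) e.
have exP : exists N, P N.
  by exists (d z); apply/hasP; exists z; rewrite // cz eqxx.
have ubP N : P N -> (N <= \max_(y <- e) d y)%N.
  by move=> /hasP[y ye /andP[_ /eqP <-]]; apply: leq_bigmax_seq.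
case: (ex_maxnP exP ubP) => N /hasP[t te /andP[ct /eqP dt]] maxN.
pose psi : {additive K -> K} :=
  HB.pack (iter (m + N) phi)
    (GRing.isZmodMorphism.Build _ _ _ (iter_zmod_morphism phi (m + N))).
have sumK : \sum_(y <- e) x (d y) *~ c y = 0.
  apply: fI; rewrite raddf0 raddf_sum; apply: (etrans _ sum0).
  by rewrite big_seq [RHS]big_seq; apply: eq_bigr => y ye; rewrite raddfMz ed.
have := congr1 psi sumK.
rewrite raddf0 raddf_sum (bigD1_seq t)// big1_seq; last first.
  move=> y /andP[yt ye].
  have [->|cy] := eqVneq (c y) 0; first by rewrite mulr0z raddf0.
  have dy : (d y < N)%N.
    rewrite ltn_neqAle maxN ?andbT; last first.
      by apply/hasP; exists y; rewrite // cy eqxx.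
    by apply: contra_neq yt => dy; rewrite -(ed y ye) -(ed t te) dy dt.
  rewrite raddfMz /= -(subnK (ltnW dy)) addnA iterD pull.
  by rewrite kill ?mul0rz// -[X in (X < _)%N]addn0 ltn_add2l subn_gt0.
rewrite [X in X = _]addr0 raddfMz /= dt iterD pull.
have tfK := torsion_free_inj fI tf.
by move=> /(torsion_free_mulrz_eq0 tfK)/(_ (elimN eqP ct))/xm.
Qed.

(** * Strings in rank one *)

(** If [u a^n + v b^n = 1], then [z = a^n (u z + v y)], and [p^n] divides
[a^n]. *)
Lemma coprime_divisible (K : zmodType) (z : K) (a b : int) (p n : nat) :
    coprimez a b -> (p %| `|a|)%N ->
    (exists y, z *~ (b ^+ n) = y *~ (a ^+ n)) ->
  exists y, z = y *+ (p ^ n).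
Proof.
move=> ab pa [y yE].
have /coprimezP[[u v] /= uv] : coprimez (a ^+ n) (b ^+ n).
  exact/coprimezXl/coprimezXr.
have /dvdzP[r rE] : ((p ^ n)%N%:Z %| a ^+ n)%Z.
  by rewrite dvdzE abszX dvdn_exp2r.
exists (z *~ (u * r) + y *~ (v * r)).
rewrite pmulrn mulrzDl -!mulrzA -!mulrA -rE [v * _]mulrC (mulrzA y) -yE -mulrzA.
by rewrite [_ * v]mulrC -mulrzDr uv.
Qed.

Lemma prime_dvd_nonunit_int (a : int) :
  `|a|%N <> 1%N -> exists2 p, prime p & (p %| `|a|)%N.
Proof.
move=> a1; case: (posnP `|a|%N) => [->|a0]; first by exists 2%N.
exists (pdiv `|a|); last exact: pdiv_dvd.
by apply: pdiv_prime; rewrite ltn_neqAle a0 andbT eq_sym; apply/eqP.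
Qed.

(** A relation between [phi h] and [h] gives the fraction, reduced by the gcd
of its terms; it is valid everywhere because every [z] has a nonzero multiple
that is a multiple of [h]. *)
Lemma dependent_endo_rational (K : zmodType) (phi : {additive K -> K}) (h : K) :
    torsion_free K ->
    pairwise_dependent K -> h <> 0 ->
  exists a b : int, coprimez a b /\ forall z, phi z *~ b = z *~ a.
Proof.
move=> tf dep h0.
have [b [a [ab phih]]] := dep (phi h) h.
have b0 : b <> 0.
  move=> b0; apply: ab; rewrite b0; congr pair; apply: contrapT => a0.
  apply: h0; apply: (torsion_free_mulrz_eq0 tf _ a0).
  by rewrite -phih b0 mulr0z.
pose g : int := gcdz a b.
have g0 : g <> 0.
  by apply/eqP; rewrite gcdz_eq0 negb_and; apply/orP; right; apply/eqP.
have aE : a = (a %/ g)%Z * g by rewrite divzK ?dvdz_gcdl.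
have bE : b = (b %/ g)%Z * g by rewrite divzK ?dvdz_gcdr.
set a' := (a %/ g)%Z in aE; set b' := (b %/ g)%Z in bE.
have ab' : coprimez a' b'.
  have [u [v uvg]] := Bezoutz a b; apply/coprimezP; exists (u, v) => /=.
  apply: (@mulIf _ g); first exact/eqP.
  by rewrite mul1r mulrDl -!mulrA -aE -bE.
exists a', b'; split=> // z.
have [c [d [cd czh]]] := dep z h.
have c0 : c <> 0.
  move=> c0; apply: cd; rewrite c0; congr pair; apply: contrapT => d0.
  by apply: h0; apply: (torsion_free_mulrz_eq0 tf _ d0); rewrite -czh c0 mulr0z.
apply/eqP; rewrite -subr_eq0; apply/eqP.
apply: (torsion_free_mulrz_eq0 tf _ c0).
apply: (torsion_free_mulrz_eq0 tf _ g0).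
have scale (y : K) (n n' : int) : n = n' * g -> y *~ n' *~ c *~ g = y *~ c *~ n.
  by move=> ->; rewrite (mulrzAC _ n') -(mulrzA _ n').
rewrite !mulrzBl (scale _ _ _ aE) (scale _ _ _ bE) czh -raddfMz czh raddfMz.
by rewrite (mulrzAC b) phih mulrzAC subrr.
Qed.

(** If [phi] is multiplication by [a / b], going backwards along the string
divides by powers of [a] and going forwards by powers of [b]. When neither has a
prime factor, [phi] is an involution and [x_2 = x_0]. *)
Lemma dependent_string_divisible (K : zmodType) (phi : {additive K -> K}) x :
    torsion_free K ->
    pairwise_dependent K ->
    is_string phi x ->
  exists (z : K) (p : nat),
    [/\ z <> 0, prime p & forall n, exists y, z = y *+ (p ^ n)].
Proof.
move=> tf dep sx; have [xI xS] := sx.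
have [i xi] : exists i, x i <> 0.
  apply: contrapT => no; have x0 j : x j = 0.
    by apply: contrapT => xj; apply: no; exists j.
  by have /xI : x 0 = x 1 by rewrite !x0.
have [a [b [ab phiE]]] := dependent_endo_rational phi tf dep xi.
have iterE n z : iter n phi z *~ (b ^+ n) = z *~ (a ^+ n).
  elim: n z => [|n IH] z; first by [].
  by rewrite !exprSr iterSr !mulrzA IH mulrzAC phiE mulrzAC.
have [a1|/prime_dvd_nonunit_int[p pp pa]] := pselect (`|a|%N = 1%N); last first.
  exists (x i), p; split=> // n; apply: (coprime_divisible ab pa).
  by exists (x (n + i)); rewrite -iterE iter_string.
have [b1|/prime_dvd_nonunit_int[p pp pb]] := pselect (`|b|%N = 1%N); last first.
  exists (x i), p; split=> // n; rewrite coprimez_sym in ab.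
  by apply: (coprime_divisible ab pb); exists (iter n phi (x i)).
(* Now [phi^2] is the identity, whereas [phi^2] maps [x 2] to [x 0]. *)
have sqr1 (c : int) : `|c|%N = 1%N -> c ^+ 2 = 1 by case: c => [[|[]]|[]].
have := iterE 2 (x 2); rewrite !sqr1// -[X in x X]/(2 + 0)%N iter_string//.
by move=> /xI.
Qed.

(** * The dichotomy *)

Lemma height_infinite (R : realType) (G : zmodType) p (x : G) :
  height R p x = +oo%E <-> forall n, exists y, x = y *+ (p ^ n).
Proof.
split=> [hx n|div].
  have /ereal_sup_gt[_ [m [y ->] <-]] : (n%:R%:E < height R p x)%E.
    by rewrite hx ltry.
  rewrite lte_fin ltr_nat => /ltnW nm; exists (y *+ p ^ (m - n)).
  by rewrite -mulrnA -expnD subnK.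
apply/eqyP => r r0; apply: le_trans (ereal_sup_ubound _); last first.
  by exists (Num.bound r) => //; exact: div.
by rewrite lee_fin ltW// archi_boundP// ltW.
Qed.

Section Dichotomy.
Variables (R : realType) (G : zmodType) (tfG : torsion_free G).

(** A string in a subgroup provides an element of infinite height in the
subgroup, and heights can only grow when passing to [G]. *)
Lemma hered_s_eq0 :
  (r0 R G <= 1)%E -> ~ infinity_in_type R G -> hered_s R G = 0%E.
Proof.
move=> /r0_le1P dep noinf; rewrite hered_sE; apply/hered_num_eq0 => H phi x sx.
pose v : {additive subgroup_of H -> G} := \val.
have tfH : torsion_free (subgroup_of H).
  exact: (torsion_free_inj (f := v) val_inj).
have depH : pairwise_dependent (subgroup_of H).
  move=> y z; have [a [b [ab e]]] := dep (v y) (v z); exists a, b; split=> //.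
  by apply: (@val_inj _ _ (subgroup_of H)); rewrite -![val _]/(v _) !raddfMz.
have [z [p [z0 pp div]]] := dependent_string_divisible tfH depH sx.
apply: noinf; exists (v z); split.
  move=> vz0; apply: z0; apply: val_inj.
  by rewrite -[LHS]/(v z) vz0 -(raddf0 v).
exists p; split=> //; apply/height_infinite => n.
by have [y ->] := div n; exists (v y); rewrite raddfMn.
Qed.

Lemma hered_ns_eqy :
  ~ ((r0 R G <= 1)%E /\ ~ infinity_in_type R G) -> hered_ns R G = +oo%E.
Proof.
move=> /not_andP[|/contrapT[x [x0 [p [pp /height_infinite div]]]]]; last first.
  exact: (hered_ns_eqy_of_divisible R tfG x0 (prime_gt1 pp) div).
move=> r1; apply: contrapT => nsy; apply: r1; apply/r0_le1P => x y.
apply: contrapT => xy; apply: nsy.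
apply: (@hered_ns_eqy_of_free_pair R G x y) => a b e.
apply: contrapT => ab; apply: xy; exists a, b; split=> // -[a0 b0].
exact: ab.
Qed.

Lemma hered_s0_eq0 : hered_s0 R G = 0%E <-> (r0 R G < +oo)%E.
Proof.
split=> [s00|r0fin].
  apply: contrapT => /infinite_rank_free_sequence[e e_free].
  exact: (hered_s0_neq0_of_free_sequence (R := R) e_free).
rewrite hered_s0E; apply/hered_num_eq0 => H phi x nx.
pose v : {additive subgroup_of H -> G} := \val.
have vI : injective v by exact: val_inj.
have ind := null_string_Z_independent vI tfG nx.
have [[xI _] _ _] := nx.
move: r0fin; rewrite (infinite_Z_independent_r0 R ind) ?ltxx//.
exact: infinite_range (inj_comp vI xI).
Qed.

End Dichotomy.

Local Open Scope ereal_scope.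

Theorem lemma7p4 (R : realType) (G : zmodType) (hG : torsion_free G) :
  [/\ hered_s0 R G = 0 <-> r0 R G < +oo,
      hered_s R G = hered_ns R G
    & hered_s R G = 0 <-> r0 R G <= 1 /\ ~ infinity_in_type R G].
Proof.
have [[r1 noinf]|bad] := pselect (r0 R G <= 1 /\ ~ infinity_in_type R G).
  have s0 := hered_s_eq0 hG r1 noinf.
  split; first exact: hered_s0_eq0.
    rewrite s0; apply/eqP; rewrite eq_le -{2}s0 hered_ns_le andbT.
    exact: hered_num_ge0.
  by [].
have nsy := hered_ns_eqy hG bad.
have sy : hered_s R G = +oo.
  by apply/eqP; rewrite -leye_eq -nsy; exact: hered_ns_le.
by split; [exact: hered_s0_eq0 | rewrite sy nsy | rewrite sy; split].
Qed.
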